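(* (The Alpha Test.) Let $1\le k\le n$, $w\in\mathcal{W}_{n,k}$, and $J\in\binom{[n]}{[k]}$ with $|J|=h$. Write $\alpha_i=\alpha_i(w)$. Then (1) $J\in S_w$ if and only if $\{\alpha_1,\dots,\alpha_h\}\trianglelefteq\alpha_J(w)$ and $\{\alpha_1,\dots,\alpha_h\}\neq\alpha_J(w)$; (2) $J\in T_w$ if and only if $\{\alpha_1,\dots,\alpha_h\}\not\trianglelefteq\alpha_J(w)$; (3) $J\in U_w$ if and only if $\{\alpha_1,\dots,\alpha_h\}=\alpha_J(w)$ (as multisets).
   Context: A Fubini word $w=w_1\cdots w_n\in\mathcal{W}_{n,k}$ is a surjection $w:[n]\to[k]$, $w_j=w(j)$. $\alpha_i(w)$ is the position of the first occurrence of the letter $i$ in $w$; for $J\subseteq[n]$, $\alpha_J(w)$ is the multiset $\{\alpha_{w(j)}(w) : j\in J\}$. Gale order on multisets of positive integers of the same size: $A\trianglelefteq B$ iff, listing $A=\{a_1\le\dots\le a_h\}$ and $B=\{b_1\le\dots\le b_h\}$, we have $a_i\le b_i$ for all $i$. Let $\mathcal{F}_{k\times n}(\mathbb{C})$ be the complex $k\times n$ matrices of rank $k$ with no zero column and $X_{n,k}$ its quotient by the right action of invertible diagonal $n\times n$ matrices. $M_w$ is the $k\times n$ matrix with $1$ in position $(w_j,j)$ for each $j$, $0$ elsewhere; $\mathrm{in}(w)=\{\alpha_1(w),\dots,\alpha_k(w)\}$. The pattern matrix $P_w$ is obtained from $M_w$ by replacing the $0$ in position $(w_i,j)$ by $\star$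 whenever $i\in\mathrm{in}(w)$, $i<\alpha_{w_j}(w)$, and either ($j\in\mathrm{in}(w)$ and $w_i<w_j$) or $j\notin\mathrm{in}(w)$; $P_w$ also denotes the set of complex matrices obtained by substituting complex numbers for the $\star$'s. With $U$ the $k\times k$ lower unitriangular matrices, the PR cell $C_w$ is $UP_w=\{XY: X\in U, Y\in P_w\}$. $\binom{[n]}{[k]}$ is the set of subsets of $[n]$ of size between $1$ and $k$; for $J$ in it, the flag minor $\Delta_J(A)$ is the determinant of the submatrix of $A$ in rows $1,\dots,|J|$ and columns $J$. Define $S_w=\{J : \exists A,B\in C_w,\ \Delta_J(A)=0\neq\Delta_J(B)\}$, $T_w=\{J : \Delta_J(M)=0\ \forall M\in C_w\}$, $U_w=\{J : \Delta_J(M)\neq0\ \forall M\in C_w\}$. *)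

(* Defs.v *)
From mathcomp Require Import all_boot all_order all_algebra.
From mathcomp Require Import finmap multiset.
From mathcomp Require Import classical_sets reals.
From mathcomp Require Import complex.

Set Implicit Arguments.
Unset Strict Implicit.
Unset Printing Implicit Defensive.

Import GRing.Theory.

Local Open Scope ring_scope.
Local Open Scope mset_scope.
Local Open Scope classical_set_scope.

(* Positions and letters are 0-based: [n] is 'I_n and [k] is 'I_k. All position
   values are thereby shifted by one, which affects neither equality of
   multisets nor the Gale order. *)

Definition fubini_word n k (w : {ffun 'I_n -> 'I_k}) : Prop :=
  forall i : 'I_k, exists j : 'I_n, w j = i.

(* Position of the first occurrence of the letter i in w; it takes the junk
   value n if i does not occur, which is impossible in a Fubini word. *)
Definition alpha n k (w : {ffun 'I_n -> 'I_k}) (i : 'I_k) : nat :=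
  index i (codom w).

Definition alpha_mset n k (w : {ffun 'I_n -> 'I_k}) (J : {set 'I_n}) :
    {mset nat} :=
  seq_mset [seq alpha w (w j) | j <- enum J].

(* The multiset {alpha_1, ..., alpha_h}. *)
Definition alpha_init n k (w : {ffun 'I_n -> 'I_k}) (h : nat) : {mset nat} :=
  seq_mset [seq alpha w i | i : 'I_k <- enum 'I_k & (i < h)%N].

(* all2 also requires both lists to have the same size. *)
Definition gale_le (A B : {mset nat}) : bool :=
  all2 leq (sort leq A) (sort leq B).

Definition initial n k (w : {ffun 'I_n -> 'I_k}) : {set 'I_n} :=
  [set j : 'I_n | [exists i : 'I_k, alpha w i == j :> nat]]%SET.

(* Whether position (r, j) of the pattern matrix holds a star. The entry
   replaced is automatically a 0 of M_w: if i is initial and w i = w j, then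
   alpha w (w j) = i. *)
Definition star n k (w : {ffun 'I_n -> 'I_k}) (r : 'I_k) (j : 'I_n) : bool :=
  [exists i in initial w,
    [&& w i == r, (i < alpha w (w j))%N &
        ((j \in initial w) && (w i < w j)%N) || (j \notin initial w)]].

(* A nonempty set of at most k columns. *)
Definition flag_index n k := {J : {set 'I_n} | (0 < #|J| <= k)%N}.

Lemma flag_index_le n k (J : flag_index n k) : (#|sval J| <= k)%N.
Proof. by case/andP: (valP J). Qed.

Section Cells.
Variables (R : realType) (n k : nat).
Implicit Types (w : {ffun 'I_n -> 'I_k}) (J : flag_index n k).

Definition word_mx w : 'M[R[i]]_(k, n) :=
  \matrix_(r < k, j < n) (w j == r)%:R.

Definition pattern_set w : set 'M[R[i]]_(k, n) :=
  [set Y | forall r j, ~~ star w r j -> Y r j = word_mx w r j].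

Definition lower_unitriangular : set 'M[R[i]]_k :=
  [set X | is_trig_mx X /\ forall r, X r r = 1].

Definition PR_cell w : set 'M[R[i]]_(k, n) :=
  [set A | exists X Y,
     [/\ lower_unitriangular X, pattern_set w Y & A = X *m Y]].

(* enum_val lists the columns of J in increasing order. *)
Definition flag_minor J (A : 'M[R[i]]_(k, n)) : R[i] :=
  \det (mxsub (widen_ord (flag_index_le J)) (@enum_val _ (mem (sval J))) A).

Definition S_set w : set (flag_index n k) :=
  [set J | exists A B, [/\ PR_cell w A, PR_cell w B,
                           flag_minor J A = 0 & flag_minor J B != 0]].

Definition T_set w : set (flag_index n k) :=
  [set J | forall M, PR_cell w M -> flag_minor J M = 0].

Definition U_set w : set (flag_index n k) :=
  [set J | forall M, PR_cell w M -> flag_minor J M != 0].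

End Cells.

Arguments S_set R {n k} w.
Arguments T_set R {n k} w.
Arguments U_set R {n k} w.

(* Main.v *)
Require Import Defs.
From mathcomp Require Import all_boot all_order all_algebra all_fingroup.
From mathcomp Require Import finmap multiset.
From mathcomp Require Import classical_sets reals.
From mathcomp Require Import complex.

(* Flag minors are unchanged by lower unitriangular row operations, so they can
   be computed on the pattern Y. An entry (r, j) of Y can be nonzero only if
   alpha_r <= alpha_(w_j); hence a nonzero term in the Leibniz expansion of the
   minor is a matching of rows r < h with columns j in J satisfying these
   inequalities, which exists exactly when the Gale inequality holds. When the
   two multisets agree there is only one such matching and its entries are all
   1. When Gale holds, match as many rows as possible with a 1 of Y (in the
   initial column when available); the remaining matched entries are stars.
   Setting these stars to b and all others to 0 makes the minor +-b^s, where s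
   is the number of matched stars, and s > 0 unless the multisets agree: b = 1
   and b = 0 give the required matrices. *)

(** * Gale order and matchings *)

Lemma all2_nthP (T : Type) (x0 : T) (r : rel T) (s t : seq T) :
  reflect (size s = size t /\ forall i, i < size s -> r (nth x0 s i) (nth x0 t i))
          (all2 r s t).
Proof.
rewrite all2E; apply: (iffP andP) => [[/eqP e] | [e H]].
  move/(all_nthP (x0, x0)); rewrite size_zip -e minnn => H; split=> // i lti.
  by have := H i lti; rewrite nth_zip.
split; first exact/eqP.
apply/(all_nthP (x0, x0)) => i; rewrite size_zip -e minnn => lti.
by rewrite nth_zip //= H.
Qed.

Lemma count_leq_nth_sorted (s : seq nat) i : sorted leq s -> i < size s ->
  i < count (geq (nth 0 s i)) s.
Proof.
move=> ss lti; rewrite -(cat_take_drop i.+1 s) count_cat cat_take_drop.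
suff /eqP-> : count (geq (nth 0 s i)) (take i.+1 s) == size (take i.+1 s).
  by rewrite size_take_min (minn_idPl lti) leq_addr.
rewrite -all_count; apply/(all_nthP 0) => j.
rewrite size_take_min (minn_idPl lti) => ltj; rewrite nth_take //=.
by rewrite (sorted_leq_nth leq_trans leqnn) ?inE //; apply: leq_trans lti.
Qed.

Lemma count_leq_sorted (s : seq nat) i b : sorted leq s -> i < size s ->
  b < nth 0 s i -> count (geq b) s <= i.
Proof.
move=> ss lti ltb; rewrite -{1}(cat_take_drop i s) count_cat.
suff /eqP-> : count (geq b) (drop i s) == 0.
  by rewrite addn0 (leq_trans (count_size _ _)) // size_take_min geq_minl.
rewrite -leqn0 leqNgt -has_count; apply/(has_nthP 0) => -[j].
rewrite size_drop => ltj; rewrite nth_drop /= => leb.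
have := leq_trans ltb (sorted_leq_nth leq_trans leqnn 0 ss i (i + j) _ _ _).
by rewrite ltnNge leb !inE lti -ltn_subRL ltj leq_addr => /(_ isT isT isT).
Qed.

Lemma perm_map_enum (T : finType) (t : {perm T}) :
  perm_eq [seq t x | x <- enum T] (enum T).
Proof.
apply: uniq_perm; rewrite ?enum_uniq //.
  by rewrite map_inj_uniq ?enum_uniq //; apply: perm_inj.
move=> x; rewrite mem_enum inE; apply/mapP; exists (t^-1%g x).
  by rewrite mem_enum.
by rewrite permKV.
Qed.

(** Composing the two sorting permutations gives [t]. Conversely, if the [i]-th smallest value [b]
    of [g] were below that of [f], more than [i] values of [g] would be at most [b], hence through
    [t] more than [i] values of [f]: a contradiction. *)
Lemma gale_leP (h : nat) (f g : 'I_h -> nat) :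
  reflect (exists t : {perm 'I_h}, forall r, f r <= g (t r))
    (gale_le (seq_mset [seq f i | i <- enum 'I_h])
             (seq_mset [seq g i | i <- enum 'I_h])).
Proof.
have sortE (s : seq nat) : sort leq (seq_mset s) = sort leq s.
  by apply/perm_sortP; [exact: leq_total | exact: leq_trans | exact: anti_leq
    | exact: perm_eq_seq_mset].
have sortedE (s : seq nat) : sorted leq (sort leq s).
  exact: (sort_sorted leq_total).
have sizeE (u : 'I_h -> nat) : size (sort leq [seq u i | i <- enum 'I_h]) = h.
  by rewrite size_sort size_map size_enum_ord.
rewrite /gale_le !sortE; apply: (iffP (all2_nthP _ 0 _ _ _)); last first.
  case=> t le_t; split=> [|i]; rewrite !sizeE // => lti.
  rewrite leqNgt; apply/negP => ltgf.
  have := count_leq_sorted _ _ _ (sortedE _) _ ltgf.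
  rewrite sizeE => /(_ lti); rewrite leqNgt => /negP[].
  have := count_leq_nth_sorted (sort leq [seq g i | i <- enum 'I_h]) i (sortedE _).
  rewrite sizeE => /(_ lti) /leq_trans; apply.
  set b := nth 0 _ i; rewrite !(seq.permP (permEl (perm_sort _ _))).
  rewrite (count_map g) (count_map f) -(seq.permP (perm_map_enum _ t) _) count_map.
  by apply: sub_count => r /=; apply: leq_trans.
have sort_perm (u : 'I_h -> nat) : exists p : {perm 'I_h},
    forall i : 'I_h, nth 0 (sort leq [seq u i | i <- enum 'I_h]) i = u (p i).
  pose U := [tuple u i | i < h].
  have /tuple_permP[p Ep] : perm_eq (sort leq U) U by rewrite perm_sort.
  exists p => i; rewrite [sort _ _]Ep -tnth_nth tnth_mktuple.
  by rewrite tnth_mktuple.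
have [p Ep] := sort_perm f; have [q Eq] := sort_perm g.
case=> _; rewrite sizeE => H.
exists (p^-1 * q)%g => r; rewrite permM.
by have := H (p^-1%g r) (ltn_ord _); rewrite Ep Eq permKV.
Qed.

(* Take an admissible matching of maximal total weight, where r matched to c
   weighs [(g c == f r) * m c]; exchanging along a violation of the conclusion
   would keep it admissible and raise its weight. *)
Lemma exchange_matching (h : nat) (f g : 'I_h -> nat) (m : 'I_h -> nat)
    (t0 : {perm 'I_h}) : injective f -> (forall r, f r <= g (t0 r)) ->
  exists t : {perm 'I_h}, (forall r, f r <= g (t r)) /\
    forall r c, (g c == f r) * m c <= (g (t r) == f r) * m (t r).
Proof.
move=> f_inj ok0; pose phi r c := (g c == f r) * m c.
pose ok (t : {perm 'I_h}) := [forall r, f r <= g (t r)].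
have ok_t0 : ok t0 by apply/forallP.
case: (arg_maxnP (fun t : {perm 'I_h} => \sum_r phi r (t r)) ok_t0).
move=> t /forallP ok_t max_t; exists t; split=> // r c.
rewrite leqNgt; apply/negP => lt_phi.
pose r' := (t^-1)%g c; have tr' : t r' = c by rewrite permKV.
have gc : g c = f r by apply/eqP; case: (g c == f r) lt_phi => //=; rewrite mul0n.
have nrr' : r' != r.
  by apply: contraTneq lt_phi => e; rewrite -[in g c]tr' -[in m c]tr' e ltnn.
have le_r' : f r' <= g (t r).
  by rewrite (leq_trans (ok_t r')) // tr' gc.
pose t' := (tperm r r' * t)%g.
have t'r : t' r = c by rewrite permM tpermL.
have t'r' : t' r' = t r by rewrite permM tpermR.
have t'D x : x != r -> x != r' -> t' x = t x.
  by move=> xr xr'; rewrite permM tpermD // eq_sym.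
have ok_t' : ok t'.
  apply/forallP => x; have [->|xr] := eqVneq x r; first by rewrite t'r gc.
  by have [->|xr'] := eqVneq x r'; rewrite ?t'r' ?t'D.
have := max_t _ ok_t'; apply/negP; rewrite -ltnNge.
rewrite (bigD1 r) //= [X in _ < X](bigD1 r) //= t'r -addSn.
apply: leq_add => //; apply: leq_sum => x xr.
(* Row [r'] has nothing to lose: its old column has value [f r], which differs from [f r'] by
   injectivity. *)
have [->|xr'] := eqVneq x r'; last by rewrite t'D.
rewrite /phi tr' gc; case: eqP => // /f_inj e.
by rewrite e eqxx in nrr'.
Qed.

(** Both families have the same sum, so the nonnegative differences all vanish. *)
Lemma perm_leq_eq (h : nat) (f g : 'I_h -> nat) (t : {perm 'I_h}) :
  perm_eq [seq f i | i <- enum 'I_h] [seq g i | i <- enum 'I_h] ->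
  (forall r, f r <= g (t r)) -> forall r, g (t r) = f r.
Proof.
move=> fg le_fg r.
have sum0 : \sum_r (g (t r) - f r) = 0.
  rewrite sumnB // -(reindex_inj (F := g) (P := xpredT) (@perm_inj _ t)) /=.
  have sumE u : \sum_(i <- [seq u i | i <- enum 'I_h]) i = \sum_i u i.
    by rewrite (big_map u) big_enum.
  by rewrite -!sumE (perm_big _ fg) subnn.
apply/eqP; rewrite eqn_leq le_fg andbT -subn_eq0.
by move/eqP: sum0; rewrite sum_nat_eq0 => /forallP/(_ r).
Qed.

Lemma det_unique_perm (R : comPzRingType) (h : nat) (A : 'M[R]_h)
    (t : {perm 'I_h}) :
  (forall s : {perm 'I_h}, s != t -> exists r, A r (s r) = 0%R) ->
  (\det A = (-1) ^+ t * \prod_r A r (t r))%R.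
Proof.
move=> H; rewrite /determinant (bigD1 t) //=.
rewrite [X in (_ + X)%R]big1 ?GRing.addr0 // => s /H[r Ar].
by rewrite (bigD1 r) //= Ar GRing.mul0r GRing.mulr0.
Qed.

(** * First occurrences in a Fubini word *)

Section FubiniWord.
Variables (n k : nat) (w : {ffun 'I_n -> 'I_k}).
Hypothesis hw : fubini_word w.

Lemma alpha_first (i : 'I_k) : exists2 j : 'I_n, w j = i & alpha w i = j.
Proof.
have [j0 wj0] := hw i.
have iw : i \in codom w by apply/codomP; exists j0.
have lta : alpha w i < n by rewrite -index_mem size_codom card_ord in iw.
exists (Ordinal lta) => //; rewrite -[RHS](nth_index i iw) codomE.
rewrite (nth_map j0) ?size_enum_ord -/(codom w) //.
by congr (w _); apply: val_inj; rewrite /= nth_enum_ord.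
Qed.

Lemma alpha_inj : injective (alpha w).
Proof.
move=> i i'; have [j <- ->] := alpha_first i; have [j' <- ->] := alpha_first i'.
by move/val_inj=> ->.
Qed.

Lemma initialP (j : 'I_n) : reflect (alpha w (w j) = j) (j \in initial w).
Proof.
rewrite inE; apply: (iffP existsP) => [[i /eqP e]|e]; last first.
  by exists (w j); rewrite e.
have [j' wj' e'] := alpha_first i; rewrite e' in e.
by rewrite -(val_inj e) wj'.
Qed.

(** The position quantified in [star] is forced: the only initial position with letter [r] is
    [alpha w r]. *)
Lemma starE (r : 'I_k) (j : 'I_n) :
  star w r j = (alpha w r < alpha w (w j)) && ((j \in initial w) ==> (r < w j)).
Proof.
have -> : (j \in initial w) ==> (r < w j) =
    (j \in initial w) && (r < w j) || (j \notin initial w).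
  by case: (j \in initial w); rewrite /= ?orbF.
apply/exists_inP/andP => [[i /initialP e /and3P[/eqP wi lt H]]|[lt H]].
  by rewrite -wi e lt.
have [i wi ei] := alpha_first r; exists i; first by apply/initialP; rewrite wi.
by rewrite wi eqxx -ei lt.
Qed.

End FubiniWord.

Arguments alpha_inj {n k w}.
Arguments initialP {n k w} hw {j}.

(** The first [#|sval J|] rows of [X] vanish beyond their leading square block, so this block, of
    determinant 1, factors out. *)
Lemma flag_minor_mul (R : realType) (n k : nat) (J : flag_index n k)
    (X : 'M[R[i]%C]_k) (Y : 'M[R[i]%C]_(k, n)) :
  lower_unitriangular X -> flag_minor J (X *m Y)%R = flag_minor J Y.
Proof.
case=> /is_trig_mxP Xtrig X1; rewrite /flag_minor; set p := widen_ord _.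
set q := enum_val.
have -> : mxsub p q (X *m Y)%R = (mxsub p p X *m mxsub p q Y)%R.
  apply/matrixP => r c; rewrite !mxE (bigID (fun l : 'I_k => l < #|sval J|)) /=.
  rewrite [X in (_ + X)%R]big1 ?GRing.addr0 => [|l]; last first.
    by rewrite -leqNgt => le; rewrite Xtrig ?GRing.mul0r //= (leq_trans _ le).
  rewrite (big_ord_narrow (flag_index_le J)).
  by apply: eq_bigr => l _; rewrite !mxE.
rewrite det_mulmx det_trig ?big1 ?GRing.mul1r // => [r _|]; rewrite ?mxE //.
by apply/is_trig_mxP => r c lt; rewrite mxE Xtrig.
Qed.

(** * Matchings between rows and columns of a flag minor *)

Section Matching.
Variables (R : realType) (n k : nat) (w : {ffun 'I_n -> 'I_k}).
Variable (J : flag_index n k).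
Hypothesis hw : fubini_word w.

Local Notation h := #|sval J|.
Local Notation row_of := (widen_ord (flag_index_le J)).
Local Notation col_of := (@enum_val _ (mem (sval J))).

Let rowpos (r : 'I_h) := alpha w (row_of r).
Let colpos (c : 'I_h) := alpha w (w (col_of c)).

Lemma row_of_inj : injective (row_of).
Proof. by move=> r r' /(congr1 val) /= /val_inj. Qed.

Lemma rowpos_inj : injective rowpos.
Proof. by move=> r r' /(alpha_inj hw) /row_of_inj. Qed.

(** With [alpha_msetE], this indexes both multisets by ['I_h], as [gale_leP] requires. *)
Lemma alpha_initE : alpha_init w h = seq_mset [seq rowpos r | r <- enum 'I_h].
Proof.
apply/eq_seq_msetP; rewrite (map_comp (alpha w) row_of); apply: perm_map.
apply: uniq_perm; first by rewrite filter_uniq ?enum_uniq.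
  by rewrite map_inj_uniq ?enum_uniq //; apply: row_of_inj.
move=> i; rewrite mem_filter mem_enum andbT; apply/idP/mapP => [lt|[r _ ->]].
  by exists (Ordinal lt); rewrite ?mem_enum //; apply: val_inj.
exact: (ltn_ord r).
Qed.

Lemma alpha_msetE :
  alpha_mset w (sval J) = seq_mset [seq colpos c | c <- enum 'I_h].
Proof.
apply/eq_seq_msetP; rewrite (map_comp (fun j => alpha w (w j)) col_of).
apply: perm_map; apply: uniq_perm; rewrite ?enum_uniq //.
  by rewrite map_inj_uniq ?enum_uniq //; apply: enum_val_inj.
move=> j; rewrite mem_enum; apply/idP/mapP => [jJ|[c _ ->]].
  by exists (enum_rank_in jJ j); rewrite ?mem_enum // enum_rankK_in.
exact: enum_valP.
Qed.

Lemma pattern_neq0 (Y : 'M[R[i]%C]_(k, n)) (r : 'I_k) (j : 'I_n) :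
  pattern_set w Y -> Y r j != 0%R -> alpha w r <= alpha w (w j).
Proof.
move=> Yw; have [|/Yw ->] := boolP (star w r j).
  by rewrite starE // => /andP[/ltnW].
by rewrite mxE; have [->|] := eqVneq (w j) r; rewrite //= eqxx.
Qed.

Lemma pattern_alpha_eq (Y : 'M[R[i]%C]_(k, n)) (r : 'I_k) (j : 'I_n) :
  pattern_set w Y -> alpha w (w j) = alpha w r -> Y r j = 1%R.
Proof.
move=> Yw e; rewrite Yw ?starE ?e ?ltnn // mxE.
by rewrite (alpha_inj hw _ _ e) eqxx.
Qed.

(* Among the stars, those matched by t take the value b and the others 0. *)
Definition matching_mx (t : {perm 'I_h}) (b : R[i]%C) : 'M[R[i]%C]_(k, n) :=
  (\matrix_(r, j) ((w j == r)%:R +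
    (if [exists q, [&& row_of q == r, col_of (t q) == j & w j != r]]
     then b else 0)))%R.

Section Optimal.
(* The weight prefers, for each letter present in J, its initial column: the
   other columns of that letter carry a star in every row of smaller alpha. *)
Variable t : {perm 'I_h}.
Hypothesis le_t : forall r, rowpos r <= colpos (t r).
Hypothesis opt_t : forall r c,
  (colpos c == rowpos r) * (col_of c \in initial w).+1
    <= (colpos (t r) == rowpos r) * (col_of (t r) \in initial w).+1.

Lemma matching_mx_pattern b : pattern_set w (matching_mx t b).
Proof.
move=> r j nstar; rewrite !mxE; case: ifP; last by rewrite GRing.addr0.
case/existsP=> q /and3P[/eqP rq /eqP jq wj]; case/negP: nstar; rewrite starE //.
rewrite ltn_neqAle -{2}rq -{2}jq le_t andbT; apply/andP; split.
  by apply: contra wj => /eqP/(alpha_inj hw)->.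
apply/implyP=> jin; rewrite ltnNge; apply: contra wj => le_wj.
(* The letter [w j] labels a row [s] of the minor. Optimality at [s] forces [t s] to be the initial
   column of that letter, namely [j], so [s = q]. *)
have lt_wj : w j < h by rewrite (leq_ltn_trans le_wj) // -rq (ltn_ord q).
have [s rs] : exists s, row_of s = w j.
  by exists (Ordinal lt_wj); apply: val_inj.
have := opt_t s (t q).
rewrite /colpos /rowpos rs jq eqxx jin mul1n.
case: eqP => [e|]; rewrite ?mul0n // mul1n ltnS lt0b => sin.
move: e; rewrite (elimT (initialP hw) sin) (elimT (initialP hw) jin).
move/val_inj; rewrite -[RHS]jq => /enum_val_inj/perm_inj eq_q.
by rewrite -rq -eq_q rs.
Qed.

Lemma matching_mx_minor b : flag_minor J (matching_mx t b) =
  ((-1) ^+ t * \prod_r (if colpos (t r) == rowpos r then 1 else b))%R.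
Proof.
have entry0 (r c : 'I_h) : t r != c -> w (col_of c) != row_of r ->
    matching_mx t b (row_of r) (col_of c) = 0%R.
  move=> trc wc; rewrite mxE (negPf wc) GRing.add0r; case: ifP => //.
  case/existsP=> q /and3P[/eqP/row_of_inj-> /eqP/enum_val_inj e].
  by rewrite e eqxx in trc.
rewrite /flag_minor (det_unique_perm _ _ _ t) => [|s nst].
  congr (_ * _)%R; apply: eq_bigr => r _; rewrite !mxE /colpos /rowpos.
  rewrite (inj_eq (alpha_inj hw)); case: eqP => /= [e|ne].
    by case: ifP => [/existsP[q]|_]; rewrite ?andbF ?GRing.addr0.
  rewrite GRing.add0r; case: existsP => // -[]; exists r.
  by rewrite !eqxx; apply/eqP.
have [q nq] : exists q, s q != t q.
  apply/existsP; apply: contraR nst; rewrite negb_exists => /forallP H.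
  by apply/eqP/permP=> q; apply/eqP; have := H q; rewrite negbK.
(* If [s] picks a 1 in row [q], optimality makes [t] pick another 1 there. The zero then lies in
   column [t q], at the row that [s] sends to it. *)
have [e|ne] := eqVneq (w (col_of (s q))) (row_of q); last first.
  by exists q; rewrite mxE entry0 // eq_sym.
have wtq : w (col_of (t q)) = row_of q.
  have := opt_t q (s q); rewrite /colpos /rowpos e eqxx mul1n.
  by case: eqP => [/(alpha_inj hw)|]; rewrite // mul0n.
have nq' : s^-1%g (t q) != q.
  by apply: contra nq => /eqP e'; rewrite -[in s q]e' permKV.
exists (s^-1%g (t q)); rewrite permKV mxE entry0 //.
  by rewrite (inj_eq perm_inj).
by rewrite wtq (inj_eq row_of_inj) eq_sym.
Qed.

End Optimal.

(** * Vanishing of the flag minor on the cell *)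

Lemma pattern_PR_cell (Y : 'M[R[i]%C]_(k, n)) :
  pattern_set w Y -> PR_cell w Y.
Proof.
move=> Yw; exists 1%:M%R, Y; split; rewrite ?mul1mx //; split=> [|r].
  exact: scalar_mx_is_trig.
by rewrite mxE eqxx.
Qed.

Lemma flag_minor_eq0 (M : 'M[R[i]%C]_(k, n)) :
  ~~ gale_le (alpha_init w h) (alpha_mset w (sval J)) ->
  PR_cell w M -> flag_minor J M = 0%R.
Proof.
move=> ngale [X [Y [Xu Yw ->]]]; rewrite flag_minor_mul //.
rewrite /flag_minor /determinant big1 // => s _.
suff /existsP[r /eqP Yr] : [exists r, Y (row_of r) (col_of (s r)) == 0%R].
  by rewrite (bigD1 r) //= mxE Yr GRing.mul0r GRing.mulr0.
apply: contraR ngale; rewrite negb_exists => /forallP Yn0.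
rewrite alpha_initE alpha_msetE; apply/gale_leP; exists s => r.
exact: pattern_neq0 Yw (Yn0 r).
Qed.

Lemma flag_minor_neq0 (M : 'M[R[i]%C]_(k, n)) :
  alpha_init w h = alpha_mset w (sval J) ->
  PR_cell w M -> flag_minor J M != 0%R.
Proof.
rewrite alpha_initE alpha_msetE => /eq_seq_msetP eq_pos.
move=> [X [Y [Xu Yw ->]]]; rewrite flag_minor_mul //.
have eq_match := perm_leq_eq _ _ _ _ eq_pos.
have [t le_t] : exists t : {perm 'I_h}, forall r, rowpos r <= colpos (t r).
  (* A matching exists because the Gale order is reflexive. *)
  apply/gale_leP; move/eq_seq_msetP: eq_pos => ->.
  by apply/gale_leP; exists 1%g => r; rewrite perm1.
rewrite /flag_minor (det_unique_perm _ _ _ t) => [|s nst].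
  rewrite GRing.mulf_eq0 GRing.signr_eq0 /= big1 ?GRing.oner_eq0 // => r _.
  by rewrite mxE (pattern_alpha_eq _ _ _ Yw) //; apply: eq_match.
suff /existsP[r /eqP Yr] : [exists r, Y (row_of r) (col_of (s r)) == 0%R].
  by exists r; rewrite mxE.
apply: contraR nst; rewrite negb_exists => /forallP Yn0.
have le_s r : rowpos r <= colpos (s r) by apply: pattern_neq0 Yw (Yn0 r).
(* The values [colpos] are those of the injective [rowpos], permuted by [t]. *)
have colpos_inj c c' : colpos c = colpos c' -> c = c'.
  rewrite -[c](permKV t) -[c'](permKV t) !(eq_match t) //.
  by move/rowpos_inj=> ->.
apply/eqP/permP=> r; apply: colpos_inj; rewrite (eq_match s le_s).
by rewrite (eq_match t le_t).
Qed.

Lemma gale_witnesses :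
  gale_le (alpha_init w h) (alpha_mset w (sval J)) ->
  (exists2 B : 'M[R[i]%C]_(k, n), PR_cell w B & flag_minor J B != 0%R) /\
  (alpha_init w h <> alpha_mset w (sval J) ->
   exists2 A : 'M[R[i]%C]_(k, n), PR_cell w A & flag_minor J A = 0%R).
Proof.
rewrite alpha_initE alpha_msetE => /gale_leP[t0 le_t0].
(* The successor keeps all weights positive, so a row with a 1 available gets one even when no
   initial column of its letter lies in [J]. *)
have [t [le_t opt_t]] := exchange_matching _ _ _
  (fun c => (col_of c \in initial w).+1) _ rowpos_inj le_t0.
split=> [|neq].
  exists (matching_mx t 1%R).
    exact/pattern_PR_cell/matching_mx_pattern.
  rewrite matching_mx_minor // GRing.mulf_eq0 GRing.signr_eq0 /=.
  by rewrite big1 ?GRing.oner_eq0 // => r _; rewrite if_same.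
(* Without such a row, reindexing by [t] would identify the two multisets. *)
have [r ne_r] : exists r, colpos (t r) != rowpos r.
  apply/existsP; apply: contra_notT neq; rewrite negb_exists => /forallP H.
  have e : colpos \o t =1 rowpos.
    by move=> r; apply/eqP; have := H r; rewrite negbK.
  apply/eq_seq_msetP; have := perm_map colpos (perm_map_enum _ t).
  by rewrite -map_comp (eq_map e).
exists (matching_mx t 0%R); first exact/pattern_PR_cell/matching_mx_pattern.
rewrite matching_mx_minor // (bigD1 r) //= (negPf ne_r).
by rewrite GRing.mul0r GRing.mulr0.
Qed.

End Matching.

Theorem theorem1p8 (R : realType) (n k : nat) (hk : 1 <= k <= n)
    (w : {ffun 'I_n -> 'I_k}) (hw : fubini_word w)
    (J : flag_index n k) (h : nat) (hJ : #|sval J| = h) :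
  [/\ S_set R w J <->
        gale_le (alpha_init w h) (alpha_mset w (sval J)) /\
        alpha_init w h <> alpha_mset w (sval J),
      T_set R w J <-> ~ gale_le (alpha_init w h) (alpha_mset w (sval J))
    & U_set R w J <-> alpha_init w h = alpha_mset w (sval J)].
Proof.
subst h; set gale := gale_le _ _.
have zero := @flag_minor_eq0 R n k w J hw.
have nonzero := @flag_minor_neq0 R n k w J hw.
have wit := @gale_witnesses R n k w J hw.
have gale_eq : alpha_init w #|sval J| = alpha_mset w (sval J) -> gale.
  rewrite /gale => ->; rewrite alpha_msetE; apply/gale_leP.
  by exists 1%g => r; rewrite perm1.
split; split.
- case=> A [B [Aw Bw A0 B0]]; split.
    by apply: contraR B0 => /zero/(_ Bw)/eqP.
  by move=> e; have /eqP := nonzero A e Aw.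
- case=> g ne; have [[B Bw B0] /(_ ne)[A Aw A0]] := wit g.
  by exists A, B; split.
- by move=> T0 /wit[[B /T0 ->]]; rewrite eqxx.
- by move/negP=> /zero.
(* The cell contains [word_mx R w], so the minor cannot be both identically zero and nowhere zero on
   it. *)
- move=> U0; have g : gale.
    have Mw : PR_cell w (word_mx R w) by apply: pattern_PR_cell => r j _.
    by apply: contraT => /zero/(_ Mw)/eqP; rewrite (negPf (U0 _ Mw)).
  have [[B Bw _] H] := wit g.
  apply/eqP/negPn/negP=> /eqP/H[A /U0 A0 A1].
  by rewrite A1 eqxx in A0.
- by move=> e M; apply: nonzero.
Qed.
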